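(* Let $\mathcal{G}$ be a monotone graph class and let $\delta=\delta(n)>0$. Then the online exploration algorithm $\textsc{Blocking}_\delta$ is $\bigl(2(\delta+2)\cdot\textsc{OptSpan}_\delta(\mathcal{G})\bigr)$-competitive on $\mathcal{G}$.
   Context: Graphs are connected, undirected, with non-negative edge weights. A graph class is monotone if it is closed under taking subgraphs. For a graph $G$, $\textsc{OptSpan}_\delta(G)$ is the minimum lightness $w(H)/w(\mathrm{MST})$ of a $(1+\delta)$-spanner $H$ of $G$ (a subgraph with $d_H(a,b)\le(1+\delta)d_G(a,b)$ for all vertices $a,b$; $\mathrm{MST}$ a minimum spanning tree of $G$), and $\textsc{OptSpan}_\delta(\mathcal{G})=\sup\{\textsc{OptSpan}_\delta(G):G\in\mathcal{G}\}$. Online exploration: an agent starts at $v$ in an unknown graph, learns neighbours and incident edge weights upon visiting a vertex, pays edge weights, must visit all vertices and return to $v$. $\textsc{Opt}(G)$ is the length of a shortest closed walk visiting all vertices. $\rho$-competitive on $\mathcal{G}$ means $\textsc{Alg}(G,v)\le\rho\cdot\textsc{Opt}(G)$ for all $G\in\mathcal{G}$, all $v$, and all tie-breaking choices. Algorithm $\textsc{Blocking}_\delta$. A vertex is explored once visited. A boundary edge $e=(u,x)$ has $u$ explored and $x$ unexplored. $d(x,y)$ is the current length of a shortest path from $x$ to $y$ whose internal vertices are all explored. A boundary edge $e=(u,x)$ is $\delta$-blocked if there is another boundary edge $e'=(u',x')$ with $w(e')<w(e)$ and $d(u,x')\le(1+\delta)w(e)$. $\textsc{Blocking}_\delta(v)$: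 while there is a boundary edge $e=(y,x)$ that is not $\delta$-blocked and such that $y=v$ or $e$ was at some earlier time $\delta$-blocked by a boundary edge whose unexplored endpoint was $v$, do: traverse a shortest internally explored path from $v$ to $y$; traverse $e$; call $\textsc{Blocking}_\delta(x)$; traverse a shortest internally explored path from $x$ to $v$. The algorithm is the call at the start vertex. *)

(* Defs.v *)
From HB Require Import structures.
From mathcomp Require Import all_boot all_order all_algebra.
From mathcomp Require Import all_classical all_reals ereal.

Set Implicit Arguments.
Unset Strict Implicit.
Unset Printing Implicit Defensive.

Import Order.TTheory GRing.Theory Num.Theory.

Local Open Scope ring_scope.

(* An edge of a simple graph is the two-element set of its endpoints. *)
Definition adj (V : finType) (F : {set {set V}}) : rel V :=
  fun x y => [set x; y]%SET \in F.

Record wgraph (R : realType) := WGraph {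
  vert :> finType;
  edges : {set {set vert}};
  weight : {set vert} -> R;
  edge_card : forall e, e \in edges -> #|e| = 2%N;
  weight_ge0 : forall e, e \in edges -> 0 <= weight e;
  vert_gt0 : (0 < #|vert|)%N;
  graph_connected : forall x y, connect (adj edges) x y }.

(* [f] identifies [H] with a subgraph of [G] carrying the inherited weights;
   in particular graphs isomorphic to [G] are subgraphs of [G]. *)
Definition subgraph (R : realType) (H G : wgraph R) : Prop :=
  exists f : H -> G, injective f /\
    forall e, e \in edges H ->
      (f @: e)%SET \in edges G /\ weight e = weight (f @: e)%SET.

Definition monotone_gclass (R : realType) (C : wgraph R -> Prop) : Prop :=
  forall G H : wgraph R, C G -> subgraph H G -> C H.

Section Graph.
Variables (R : realType) (G : wgraph R).
Implicit Types (F T : {set {set G}}) (S : pred G) (x y u v : G).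
Implicit Types (p q h : seq G).

(* The walk [x :: p]. *)
Fixpoint walk_length x p : R :=
  if p is y :: p' then weight [set x; y]%SET + walk_length y p' else 0.

Definition edges_weight F : R := \sum_(e in F) weight e.

(* [x :: p] is a path from [x] to [y] with edges in [F] and all internal
   vertices in [S]. *)
Definition is_path F S x y p : Prop :=
  [/\ path (adj F) x p, last x p = y, uniq (x :: p)
    & all S (behead (belast x p))].

(* +oo when there is no such path. *)
Definition dist F S x y : \bar R :=
  ereal_inf [set (walk_length x p)%:E | p in is_path F S x y]%classic.

Definition spanning_tree T : Prop :=
  [/\ T \subset edges G,
      forall x y, connect (adj T) x y
    & forall c : seq G, (2 < size c)%N -> ~~ ucycleb (adj T) c].

Definition is_mst T : Prop :=
  spanning_tree T /\
  forall T', spanning_tree T' -> edges_weight T <= edges_weight T'.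

Definition spanner (delta : R) F : Prop :=
  F \subset edges G /\
  forall a b, (dist F predT a b <= (1 + delta)%:E * dist (edges G) predT a b)%E.

(* A minimum over a nonempty finite set. If the MST has weight 0, so does the
   lightest spanner, and the ratio 0 / 0 is 0. *)
Definition opt_span (delta : R) : \bar R :=
  ereal_inf [set r | exists F T, [/\ spanner delta F, is_mst T
                & r = (edges_weight F / edges_weight T)%:E]]%classic.

(* [v :: p] is a closed walk visiting all vertices. *)
Definition tour v p : Prop :=
  [/\ path (adj (edges G)) v p, last v p = v & forall x, x \in v :: p].

Definition opt : \bar R :=
  ereal_inf [set r | exists v p, tour v p /\ r = (walk_length v p)%:E]%classic.

(* The state of the exploration is the sequence [h] of the explored vertices in
   the order in which they were explored; the states at earlier times are the
   proper prefixes of [h]. *)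
Definition boundary h u x : Prop :=
  [/\ adj (edges G) u x, u \in h & x \notin h].

Definition blocked_by (delta : R) h u x u' x' : Prop :=
  [/\ boundary h u x, boundary h u' x',
      weight [set u'; x']%SET < weight [set u; x]%SET
    & (dist (edges G) (mem h) u x' <=
       ((1 + delta) * weight [set u; x]%SET)%:E)%E].

Definition blocked (delta : R) h u x : Prop :=
  exists u' x', blocked_by delta h u x u' x'.

(* The loop condition of the call at [v] holds for the edge [(y, x)]. *)
Definition eligible (delta : R) h v y x : Prop :=
  [/\ boundary h y x, ~ blocked delta h y x
    & y = v \/ exists k u', (k < size h)%N /\
                 blocked_by delta (take k h) y x u' v].

Definition shortest_explored h x y p : Prop :=
  is_path (edges G) (mem h) x y p /\
  forall q, is_path (edges G) (mem h) x y q ->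
    walk_length x p <= walk_length x q.

(* [blocking delta v h h' t]: the call at [v] in state [h], [v] being already
   explored, can end in state [h'] after the agent has walked [v :: t]. *)
Inductive blocking (delta : R) : G -> seq G -> seq G -> seq G -> Prop :=
| BlockingDone v h :
    (forall y x, ~ eligible delta h v y x) -> blocking delta v h h [::]
| BlockingStep v h h1 h2 y x p q t1 t2 :
    eligible delta h v y x ->
    shortest_explored h v y p ->
    blocking delta x (rcons h x) h1 t1 ->
    shortest_explored h1 x v q ->
    blocking delta v h1 h2 t2 ->
    blocking delta v h h2 (p ++ x :: t1 ++ q ++ t2).

End Graph.

(* [A G v p]: on [G] with start vertex [v], for some tie-breaking, the agent
   walks [v :: p]. *)
Definition algorithm (R : realType) : Type :=
  forall G : wgraph R, G -> seq G -> Prop.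

Definition blocking_alg (R : realType) (delta : nat -> R) : algorithm R :=
  fun G v p => exists h, blocking (delta #|G|) v [:: v] h p.

Definition opt_span_class (R : realType) (delta : nat -> R)
    (C : wgraph R -> Prop) : \bar R :=
  ereal_sup [set r | exists G : wgraph R,
                       C G /\ r = opt_span G (delta #|G|)]%classic.

(* The ratio may depend on the number of vertices. *)
Definition competitive (R : realType) (rho : nat -> \bar R)
    (C : wgraph R -> Prop) (A : algorithm R) : Prop :=
  forall G : wgraph R, C G -> forall v : G,
    (exists p, A G v p) /\
    forall p, A G v p ->
      tour v p /\ ((walk_length v p)%:E <= rho #|G| * opt G)%E.

(* Main.v *)
Require Import Defs.
From mathcomp Require Import all_boot all_order all_algebra.
From mathcomp Require Import all_classical all_reals ereal.
From mathcomp Require Import lra.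

(** Let [B] be the set of the boundary edges that the algorithm traverses in order
    to explore their endpoint. An eligible edge [(y, x)] of the call at [v] has
    [y = v] or was blocked by an edge ending in [v], so [y] is within
    [(1 + delta) w(y, x)] of [v]; hence the whole walk costs at most
    [2 (delta + 2) w(B)].

    Let [T] be a minimum spanning tree that contains as many edges of [B] as
    possible. In every cycle of [T U B] all heaviest edges lie in [B], since
    otherwise an exchange would improve [T]. When the one of them that is charged
    last is traversed, it is not blocked, although the first boundary edge met on
    the rest of the cycle is strictly lighter; so the rest of the cycle is longer
    than [1 + delta] times that edge. Therefore [T U B] is its own only
    [(1 + delta)]-spanner, and since it belongs to the class,
    [w(B) <= w(T U B) <= OptSpan * w(T) <= OptSpan * Opt]. *)

Set Implicit Arguments.
Unset Strict Implicit.
Unset Printing Implicit Defensive.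

Import Order.TTheory GRing.Theory Num.Theory.

Local Open Scope ring_scope.

(** * Sums of nonnegative terms over lists and sets *)

Section SumBounds.
Variables (R : realType) (I : finType) (w : I -> R).

Lemma sum_uniq_le (l : seq I) (K : {set I}) :
  uniq l -> {subset l <= K} -> {in K, forall e, 0 <= w e} ->
  \sum_(e <- l) w e <= \sum_(e in K) w e.
Proof.
move=> ul lK w0; rewrite (big_uniq _ ul) /= [leRHS](bigID (mem l)) /=.
rewrite [X in _ <= X + _](_ : _ = \sum_(e in l) w e); last first.
  by apply: eq_bigl => e; apply/andP/idP => [[]|el]//; split=> //; exact: lK.
by rewrite lerDl sumr_ge0// => e /andP[/w0].
Qed.

Lemma sum_cover_le (l : seq I) (K : {set I}) :
  {subset K <= l} -> {in l, forall e, 0 <= w e} ->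
  \sum_(e in K) w e <= \sum_(e <- l) w e.
Proof.
elim: l K => [|a l IH] K Kl w0.
  by rewrite big_nil big_pred0// => e; apply/negP => /Kl.
have w0' : {in l, forall e, 0 <= w e}.
  by move=> e el; apply: w0; rewrite inE el orbT.
have wa : 0 <= w a by apply: w0; rewrite mem_head.
rewrite big_cons; have [aK|aK] := boolP (a \in K).
  rewrite (big_setD1 a aK) /= lerD2l IH// => e; rewrite !inE => /andP[ea /Kl].
  by rewrite inE (negPf ea).
apply: ler_wpDl => //; apply: IH => // e eK; move: (Kl _ eK).
by rewrite inE; case: eqVneq eK aK => // -> ->.
Qed.

End SumBounds.

(** * Splitting sequences *)

Section Sequences.
Variables (T : Type) (P : pred T).

Lemma split_last (s : seq T) : has P s ->
  exists s1 z s2, [/\ s = s1 ++ z :: s2, P z & ~~ has P s2].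
Proof.
elim/last_ind: s => [//|s a IH]; rewrite has_rcons.
have [Pa _|Pa /= /IH [s1 [z [s2 [-> Pz Ps2]]]]] := boolP (P a).
  by exists s, a, [::]; rewrite cats1.
exists s1, z, (rcons s2 a); split=> //; first by rewrite rcons_cat.
by rewrite has_rcons (negPf Pa).
Qed.

Lemma first_exit x (p : seq T) : P x -> ~~ P (last x p) ->
  exists p1 d p2, [/\ p = p1 ++ d :: p2, all P (x :: p1) & ~~ P d].
Proof.
elim: p x => /= [x -> //|y p IH] x Px Pl.
have [Py|Py] := boolP (P y); last by exists [::], y, p; rewrite /= Px.
have [p1 [d [p2 [-> yp1 Pd]]]] := IH y Py Pl.
by exists (y :: p1), d, p2; split=> //; rewrite /= Px.
Qed.

Lemma last_rev_belast (x : T) p : last (last x p) (rev (belast x p)) = x.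
Proof. by case: p => //= y p; rewrite rev_cons last_rcons. Qed.

End Sequences.

(** * Walks, cycles and connectivity in edge sets *)

Section EdgeSets.
Variable V : finType.
Implicit Types (F K T : {set {set V}}) (a b c x y z : V) (p q : seq V).

Fixpoint walk_edges x p : seq {set V} :=
  if p is y :: p' then [set x; y]%SET :: walk_edges y p' else [::].

Lemma adj_sym F : symmetric (adj F).
Proof. by move=> x y; rewrite /adj finset.setUC. Qed.

Lemma connect_adjC F x y : connect (adj F) x y = connect (adj F) y x.
Proof. exact: (sym_connect_sym (@adj_sym F)). Qed.

Lemma path_walk_edges F x p :
  path (adj F) x p = all (mem F) (walk_edges x p).
Proof. by elim: p x => //= y p IH x; rewrite IH. Qed.

Lemma walk_edges_cat x p q :
  walk_edges x (p ++ q) = walk_edges x p ++ walk_edges (last x p) q.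
Proof. by elim: p x => //= y p IH x; rewrite IH. Qed.

Lemma walk_edges_sub x p e z :
  e \in walk_edges x p -> z \in e -> z \in x :: p.
Proof.
elim: p x => //= y p IH x; rewrite inE => /predU1P[->|/IH ze /ze].
  by rewrite !inE => /orP[->|->]//; rewrite orbT.
by move=> zyp; rewrite inE zyp orbT.
Qed.

Lemma uniq_walk_edges x p : uniq (x :: p) -> uniq (walk_edges x p).
Proof.
elim: p x => //= y p IH x /andP[xp /[dup] up /IH ->]; rewrite andbT.
apply: contra xp => /walk_edges_sub; apply; exact: set21.
Qed.

Lemma connect_sub_adj F K x y :
  F \subset K -> connect (adj F) x y -> connect (adj K) x y.
Proof.
move=> /fintype.subsetP FK; apply: connect_sub => {}x {}y xy.
by apply: connect1; exact: FK.
Qed.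

Lemma walk_connect F x p : {subset walk_edges x p <= F} ->
  connect (adj F) x (last x p).
Proof.
by move=> /allP xpF; apply/connectP; exists p; rewrite ?path_walk_edges.
Qed.

Lemma walk_connect_mem x p z : z \in x :: p ->
  connect (adj [set e in walk_edges x p]%SET) x z.
Proof.
case/splitPl => p1 p2 <-; apply: walk_connect => e ep1.
by rewrite inE walk_edges_cat mem_cat ep1.
Qed.

Lemma connect_uniq_path (e : rel V) x y : connect e x y ->
  exists p, [/\ path e x p, last x p = y & uniq (x :: p)].
Proof.
move=> /connectP[p xp ->]; case: (shortenP xp) => q xq uq _.
by exists q.
Qed.

Lemma walk_split x p e : e \in walk_edges x p ->
  exists p1 d p2, p = p1 ++ d :: p2 /\ e = [set last x p1; d]%SET.
Proof.
elim: p x => //= y p IH x; rewrite inE => /predU1P[->|].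
  by exists [::], y, p.
by move=> /IH[p1 [d [p2 [-> ->]]]]; exists (y :: p1), d, p2.
Qed.

(* Stands for a cycle: every edge of [K] can be bypassed inside [K]. *)
Definition bridgeless K : Prop :=
  forall u x, [set u; x]%SET \in K -> connect (adj (K :\ [set u; x]%SET)) u x.

Lemma eq_set2_connect F a b c d : [set a; b]%SET = [set c; d]%SET ->
  connect (adj F) a b -> connect (adj F) c d.
Proof.
move=> E; have : a \in [set c; d]%SET by rewrite -E set21.
have : b \in [set c; d]%SET by rewrite -E set22.
have : c \in [set a; b]%SET by rewrite E set21.
have : d \in [set a; b]%SET by rewrite E set22.
rewrite !inE => /pred2P[]-> /pred2P[]->; rewrite ?eqxx//= ?connect0//.
by rewrite connect_adjC.
Qed.

(** Deleting an edge of the path leaves two arcs, which the closing edge joins; deleting the closing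
    edge leaves the path. The second hypothesis excludes a single edge walked back and forth. *)
Lemma cycle_bridgeless a p :
  uniq (a :: p) -> [set a; last a p]%SET \notin walk_edges a p ->
  bridgeless [set e in [set a; last a p]%SET :: walk_edges a p]%SET.
Proof.
move=> up eap u x; set K := [set e in _]%SET.
rewrite inE in_cons => /predU1P[E|].
  rewrite E; apply: (@eq_set2_connect _ a (last a p)); first by rewrite E.
  apply: walk_connect => f fp; rewrite !inE fp orbT andbT.
  by apply: contraNneq eap => <-.
move=> /[dup] fap /walk_split[p1 [d [p2 [pE fE]]]].
apply: (@eq_set2_connect _ (last a p1) d); first by rewrite fE.
set f := [set u; x]%SET in fap fE *.
have e_neq : [set a; last a p]%SET != f by apply: contraNneq eap => ->.
have c1 : connect (adj (K :\ f)) a (last a p1).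
  apply: walk_connect => g gp; rewrite !inE pE walk_edges_cat mem_cat gp orbT andbT.
  apply/eqP => gf; move: (@walk_edges_sub a p1 g d gp); rewrite gf fE set22 => /(_ isT) dp1.
  move: up; rewrite pE -cat_cons cat_uniq => /and3P[_ /hasPn/(_ d)].
  by rewrite mem_head dp1 => /(_ isT).
have c2 : connect (adj (K :\ f)) d (last a p).
  rewrite pE last_cat; apply: walk_connect => g gp.
  rewrite !inE pE walk_edges_cat mem_cat /= inE gp !orbT andbT.
  apply/eqP => gf; move: (@walk_edges_sub d p2 g (last a p1) gp).
  rewrite gf fE set21 => /(_ isT) dp1.
  move: up; rewrite pE -cat_cons cat_uniq => /and3P[_ /hasPn/(_ (last a p1))].
  by rewrite dp1 mem_last => /(_ isT).
have c3 : connect (adj (K :\ f)) a (last a p).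
  by apply: connect1; rewrite /adj !inE e_neq eqxx.
by rewrite connect_adjC; rewrite connect_adjC in c1;
  apply: connect_trans c2 _; rewrite connect_adjC; apply: connect_trans c1 c3.
Qed.

Lemma connect_exit F (S : pred V) a b : connect (adj F) a b -> S a -> ~~ S b ->
  exists c d, [/\ [set c; d]%SET \in F, S c & ~~ S d].
Proof.
move=> /connectP[p ap ->]; elim: p a ap => [|y p IH] a /=; first by move=> _ ->.
move=> /andP[ay yp] Sa Sb; have [Sy|Sy] := boolP (S y); first exact: IH yp Sy Sb.
by exists a, y.
Qed.

Definition edge_connected F : Prop := forall x y, connect (adj F) x y.

Lemma edge_connected_del F a b : edge_connected F ->
  connect (adj (F :\ [set a; b]%SET)) a b -> edge_connected (F :\ [set a; b]%SET).
Proof.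
move=> cF cab x y; apply: connect_sub (cF x y) => {}x {}y xy.
have [E|N] := eqVneq [set x; y]%SET [set a; b]%SET.
  exact: eq_set2_connect (esym E) cab.
by apply: connect1; rewrite /adj !inE N.
Qed.

(** No edge of [T] leaves the set of vertices reachable from [a] or [b]: the edge [ab] has both ends
    inside, and any other edge survives the deletion. *)
Lemma bridge_side T a b z : edge_connected T ->
  connect (adj (T :\ [set a; b]%SET)) a z \/ connect (adj (T :\ [set a; b]%SET)) b z.
Proof.
move=> cT; set S := fun z => connect (adj (T :\ [set a; b]%SET)) a z ||
  connect (adj (T :\ [set a; b]%SET)) b z.
apply/orP; apply: contraT => nS.
have [|c [d [cdT Sc Sd]]] := connect_exit (cT a z) _ (nS : ~~ S z).
  by rewrite /S connect0.
have [E|N] := eqVneq [set c; d]%SET [set a; b]%SET.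
  move: Sd; have : d \in [set a; b]%SET by rewrite -E set22.
  by rewrite /S !inE => /pred2P[]->; rewrite connect0 ?orbT.
have cd : connect (adj (T :\ [set a; b]%SET)) c d.
  by apply: connect1; rewrite /adj !inE N.
by case/negP: Sd; case/orP: Sc => Sc; apply/orP; [left|right];
  apply: connect_trans Sc cd.
Qed.

End EdgeSets.

Lemma finite_minimizer (R : realType) (I : finType) (P : I -> Prop) (F : I -> R) :
  (exists i, P i) -> exists i, P i /\ forall j, P j -> F i <= F j.
Proof.
move=> [i0 Pi0]; have Pi0' : [pred i | `[< P i >]] i0 by exact/asboolP.
case: (arg_minP F Pi0') => i /asboolP Pi mi.
by exists i; split=> // j Pj; apply: mi; apply/asboolP.
Qed.

(** * Spanning trees and edge exchanges *)

Section SpanningTrees.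
Variables (R : realType) (G : wgraph R).
Implicit Types (F K T B : {set {set G}}) (u v x y : G) (p q h : seq G).

Lemma edge_ends (e : {set G}) : e \in edges G ->
  exists a b, a != b /\ e = [set a; b]%SET.
Proof. by move=> /edge_card/eqP/cards2P. Qed.

Lemma edge_neq a b : [set a; b]%SET \in edges G -> a != b.
Proof.
by move=> /edge_card; rewrite cards2; case: eqP.
Qed.

Lemma walk_lengthE x p :
  walk_length x p = \sum_(e <- walk_edges x p) weight e.
Proof. by elim: p x => [|y p IH] x /=; rewrite ?big_nil// big_cons IH. Qed.

Lemma walk_length_cat x p q :
  walk_length x (p ++ q) = walk_length x p + walk_length (last x p) q.
Proof. by rewrite !walk_lengthE walk_edges_cat big_cat. Qed.

Lemma edges_weight_ge0 F : F \subset edges G -> 0 <= edges_weight F.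
Proof.
by move=> /fintype.subsetP FE; apply: sumr_ge0 => e /FE; exact: weight_ge0.
Qed.

Lemma edges_weightS F K : F \subset K -> K \subset edges G ->
  edges_weight F <= edges_weight K.
Proof.
move=> /fintype.subsetP FK /fintype.subsetP KE; rewrite /edges_weight -big_enum.
apply: sum_uniq_le; rewrite ?enum_uniq// => e; first by rewrite mem_enum => /FK.
by move=> /KE/weight_ge0.
Qed.

Lemma edges_weightD1 (e : {set G}) K : e \in K ->
  edges_weight K = weight e + edges_weight (K :\ e).
Proof. by move=> eK; rewrite /edges_weight (big_setD1 e eK). Qed.

Lemma walk_length_le_edges K x p : K \subset edges G -> uniq (x :: p) ->
  path (adj K) x p -> walk_length x p <= edges_weight K.
Proof.
move=> /fintype.subsetP KE up; rewrite path_walk_edges walk_lengthE => /allP xpK.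
apply: sum_uniq_le; [exact: uniq_walk_edges|exact: xpK|].
by move=> e /KE/weight_ge0.
Qed.

Lemma edges_weight_le_walk K x p : path (adj (edges G)) x p ->
  {subset K <= walk_edges x p} -> edges_weight K <= walk_length x p.
Proof.
rewrite path_walk_edges walk_lengthE => /allP xpE Kxp.
by apply: sum_cover_le => // e /xpE/weight_ge0.
Qed.

Lemma bridges_acyclic T :
  (forall a b, [set a; b]%SET \in T ->
     ~~ connect (adj (T :\ [set a; b]%SET)) a b) ->
  forall c : seq G, (2 < size c)%N -> ~~ ucycleb (adj T) c.
Proof.
move=> brT [//|x [//|y p]] /= sp; apply/negP; rewrite /ucycleb /=.
rewrite rcons_path => /andP[/and3P[xy yp lx] /and3P[xyp yNp up]].
have /negP := brT _ _ lx; apply.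
rewrite connect_adjC; apply: (@walk_connect _ _ x (y :: p)) => e /=.
rewrite inE => /predU1P[->|eyp]; rewrite !inE.
  rewrite [_ \in T]xy andbT; apply: contraTneq sp => E.
  have : y \in [set last y p; x]%SET by rewrite -E set22.
  rewrite !inE => /orP[/eqP yl|/eqP yx]; last by move: xyp; rewrite yx mem_head.
  by case: p yNp yl {E lx up yp xyp} => //= z p /negP yNp yl; case: yNp;
    rewrite yl mem_last.
move: yp; rewrite path_walk_edges => /allP/(_ e eyp) /= ->; rewrite andbT.
apply: contraNneq xyp => E; apply: (walk_edges_sub eyp); by rewrite E set22.
Qed.

(** A simple bypass closed up by [ab] is a cycle. It has more than two vertices, because [a] and [b]
    differ and the edge [ab] itself is deleted. *)
Lemma spanning_tree_bridge T a b : spanning_tree T -> [set a; b]%SET \in T ->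
  ~~ connect (adj (T :\ [set a; b]%SET)) a b.
Proof.
move=> [TE _ acT] abT; apply/negP => /connect_uniq_path[p [ap lp up]].
have ab : a != b by apply: edge_neq; exact: (fintype.subsetP TE).
have apT : path (adj T) a p.
  apply: sub_path ap => c d; rewrite /adj !inE => /andP[_]; exact.
have sp : (2 < size (a :: p))%N.
  case: p ap lp {up apT} => [_ /= E|c [/= /andP[+ _] E|//]].
    by rewrite E eqxx in ab.
  by rewrite /adj E !inE eqxx.
move: (acT _ sp); rewrite /ucycleb up andbT /= rcons_path apT lp /=.
by rewrite /adj finset.setUC abT.
Qed.

(** In an inclusion-minimal connected edge set within [F] every edge is a bridge, as an edge with a
    bypass could be deleted. *)
Lemma spanning_tree_exists F : F \subset edges G -> edge_connected F ->
  exists2 T : {set {set G}}, T \subset F & spanning_tree T.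
Proof.
move=> FE cF; pose P (F : {set {set G}}) := [forall x, forall y, connect (adj F) x y].
have PF : P F by apply/forallP => x; apply/forallP => y; exact: cF.
have [T mT TF] := minset_exists PF.
have cT : edge_connected T by move=> x y; apply: (forallP (forallP (minsetp mT) x)).
have TE := fintype.subset_trans TF FE; exists T => //; split=> //.
apply: bridges_acyclic => a b abT; apply/negP => cab.
have cT' := edge_connected_del cT cab.
have PT' : P (T :\ [set a; b]%SET).
  by apply/forallP => x; apply/forallP => y; exact: cT'.
have := minsetinf mT PT' (subD1set _ _) => /setP/(_ [set a; b]%SET).
by rewrite !inE abT eqxx.
Qed.

(* Ties between minimum spanning trees are broken in favour of [B]. *)
Definition is_mst_favouring B T : Prop :=
  is_mst T /\ forall T', spanning_tree T' -> edges_weight T' <= edges_weight T ->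
    (#|T :\: B| <= #|T' :\: B|)%N.

Lemma mst_favouring_exists B : exists T, is_mst_favouring B T.
Proof.
have [T0 _ T0s] := spanning_tree_exists (subxx _) (@graph_connected R G).
have [T1 [T1s T1m]] := finite_minimizer (@edges_weight R G) (ex_intro _ T0 T0s).
have [|T [mT Tm]] := @finite_minimizer R _ (@is_mst R G) (fun T => #|T :\: B|%:R).
  by exists T1.
exists T; split=> // T' sT' wT'; rewrite -(ler_nat R); apply: Tm; split=> // T2 T2s.
by apply: le_trans wT' _; case: mT => _; exact.
Qed.

(** If [f] lay outside [B], it would be a tree edge whose removal splits [T] into two sides. The
    bypass of [f] in [K] crosses between them along some [cd] outside [T], hence in [B]; swapping
    [f] for [cd] does not raise the weight and leaves fewer edges outside [B]. *)
Lemma heaviest_edge_favoured B T K (f : {set G}) :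
  is_mst_favouring B T -> B \subset edges G -> K \subset T :|: B ->
  bridgeless K -> f \in K -> (forall g, g \in K -> weight g <= weight f) ->
  f \in B.
Proof.
move=> [[sT mT] favT] BE KTB brK fK fmax; apply: contraT => fB.
have [TE cT _] := sT.
have fT : f \in T by move/fintype.subsetP: KTB => /(_ f fK); rewrite inE (negPf fB) orbF.
have [a [b [ab fE]]] := edge_ends (fintype.subsetP TE _ fT).
rewrite fE in fT fK; set S := connect (adj (T :\ [set a; b]%SET)) a.
have nSb : ~~ S b by exact: spanning_tree_bridge.
have [|c [d [cdK Sc Sd]]] := connect_exit (brK _ _ fK) _ nSb.
  exact: connect0.
move: cdK; rewrite !inE => /andP[cdab cdK].
have cdT : [set c; d]%SET \notin T.
  apply: contra Sd => cdT; apply: connect_trans Sc _; apply: connect1.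
  by rewrite /adj !inE cdab.
have cdB : [set c; d]%SET \in B.
  by move/fintype.subsetP: KTB => /(_ _ cdK); rewrite inE (negPf cdT).
pose T' := [set c; d]%SET |: T :\ [set a; b]%SET.
have subT' : T :\ [set a; b]%SET \subset T' by exact: finset.subsetUr.
have T'E : T' \subset edges G.
  rewrite finset.subUset finset.sub1set (fintype.subsetP BE)//=.
  exact: fintype.subset_trans (subD1set _ _) TE.
have cT' : edge_connected T'.
  have cab : connect (adj T') a b.
    apply: connect_trans (connect_sub_adj subT' Sc) _.
    apply: (@connect_trans _ _ d); first by apply: connect1; rewrite /adj setU11.
    rewrite connect_adjC; case: (bridge_side a b d cT) => [Sd'|cbd].
      by case/negP: Sd.
    exact: connect_sub_adj subT' cbd.
  move=> x y; apply: connect_sub (cT x y) => {}x {}y xy.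
  have [E|N] := eqVneq [set x; y]%SET [set a; b]%SET.
    exact: eq_set2_connect (esym E) cab.
  by apply: connect1; rewrite /adj !inE N /= [_ \in T]xy orbT.
have [T'' T''T' sT''] := spanning_tree_exists T'E cT'.
have wT'' : edges_weight T'' <= edges_weight T.
  apply: le_trans (edges_weightS T''T' T'E) _.
  rewrite (@edges_weightD1 [set c; d]%SET T') ?setU11// (edges_weightD1 fT).
  rewrite /T' setU1K; last by rewrite !inE negb_and cdT orbT.
  by rewrite lerD2r -fE fmax.
have := favT _ sT'' wT''; rewrite leqNgt => /negP; case.
apply: (@leq_ltn_trans #|(T :\: B) :\ f|); last first.
  by rewrite [X in (_ < X)%N](cardsD1 f) inE fB fE fT.
apply/subset_leq_card/fintype.subsetP => g.
rewrite !inE => /andP[gB /(fintype.subsetP T''T')]; rewrite !inE.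
case/predU1P => [gE|/andP[gab gT]]; first by rewrite gE cdB in gB.
by rewrite fE gab gB.
Qed.

End SpanningTrees.

(** * Shortest paths and attained distances *)

Section Paths.
Variables (R : realType) (G : wgraph R).
Implicit Types (F K T B : {set {set G}}) (S : pred G) (u v x y : G) (p q h : seq G).

Lemma shortest_path_exists F S x y : (exists p, is_path F S x y p) ->
  exists p, is_path F S x y p /\
    forall q, is_path F S x y q -> walk_length x p <= walk_length x q.
Proof.
have bnd p : is_path F S x y p -> (size p <= #|G|)%N.
  move=> [_ _ /= /andP[_ up] _]; rewrite cardE.
  by apply: uniq_leq_size => // z _; rewrite mem_enum.
move=> [p0 p0P].
pose P (b : #|G|.-bseq G) := is_path F S x y b.
have [|p [pP pm]] := @finite_minimizer R _ P (fun b => walk_length x b).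
  by exists (Bseq (bnd _ p0P)).
exists p; split=> // q qP; exact: (pm (Bseq (bnd _ qP)) qP).
Qed.

Lemma dist_le F S x y p : is_path F S x y p ->
  (dist F S x y <= (walk_length x p)%:E)%E.
Proof. by move=> pP; apply: ereal_inf_lbound; exists p. Qed.

(** Without a path the distance is [+oo], so the bound forces one to exist; the infimum is then a
    minimum. *)
Lemma dist_attained F S x y (r : R) : (dist F S x y <= r%:E)%E ->
  exists p, is_path F S x y p /\ walk_length x p <= r.
Proof.
move=> dr; have [ex|nex] := pselect (exists p, is_path F S x y p).
  have [p [pP pm]] := shortest_path_exists ex; exists p; split=> //.
  rewrite -lee_fin; apply: le_trans dr; apply: le_ereal_inf_tmp => _ [q qP <-].
  by rewrite lee_fin pm.
suff E : ([set (walk_length x p)%:E | p in is_path F S x y] = set0)%classic.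
  by move: dr; rewrite /dist E ereal_inf0.
by apply/seteqP; split=> // z [q qP _]; case: nex; exists q.
Qed.

Lemma sub_is_path F S S' x y p : {subset S <= S'} ->
  is_path F S x y p -> is_path F S' x y p.
Proof. by move=> SS' [? ? ? aS]; split=> //; apply: sub_all aS. Qed.

End Paths.

(** * The charged edges and the cycles through them *)

Section Charged.
Variables (R : realType) (G : wgraph R).
Implicit Types (F K T B : {set {set G}}) (S : pred G) (u v x y : G) (p q h : seq G).
Implicit Types (s : seq (G * G)) (delta : R).

(* [s] lists the boundary edges [(u, x)] that are traversed, from state [h] on,
   to explore their endpoint [x]. *)
Fixpoint charged (delta : R) h s : Prop :=
  if s is (u, x) :: s' then
    [/\ boundary h u x, ~ blocked delta h u x & charged delta (rcons h x) s']
  else True.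

Definition pair_edge (z : G * G) : {set G} := [set z.1; z.2]%SET.

Definition charged_edges s : {set {set G}} := [set e in map pair_edge s]%SET.

Lemma charged_cat delta h s1 s2 : charged delta h (s1 ++ s2) <->
  charged delta h s1 /\ charged delta (h ++ map snd s1) s2.
Proof.
elim: s1 h => [|[u x] s1 IH] h /=; first by rewrite cats0; split=> // -[].
rewrite -cat_rcons; split.
  by move=> [bx nb /IH[c1 c2]].
by move=> [[bx nb c1] c2]; split=> //; apply/IH.
Qed.

Lemma charged_explored delta h s z y : charged delta h s -> z \in s ->
  y \in pair_edge z -> y \in h ++ map snd s.
Proof.
elim: s h => [//|[u x] s IH] h /= [[_ uh _] _ cs].
rewrite inE => /predU1P[->|zs yz]; last first.
  by rewrite -cat_rcons; exact: IH cs zs yz.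
by rewrite !inE /= mem_cat inE => /pred2P[]->; rewrite ?uh// eqxx orbT.
Qed.

(** Each charged edge ends in a vertex that is unexplored at that time, whereas both ends of all
    earlier charged edges are explored. *)
Lemma charged_uniq delta h s : charged delta h s -> uniq (map pair_edge s).
Proof.
elim/last_ind: s => [//|s [u x] IH]; rewrite -cats1 => /charged_cat[cs].
rewrite /= => -[[_ _ xh] _ _]; rewrite map_cat cats1 rcons_uniq IH// andbT.
apply: contra xh => /mapP[z zs E]; apply: charged_explored cs zs _.
by rewrite -E /pair_edge set22.
Qed.

Lemma charged_subset delta h s : charged delta h s ->
  charged_edges s \subset edges G.
Proof.
move=> cs; apply/fintype.subsetP => e; rewrite inE => /mapP[z zs ->].
elim: s h cs zs => [//|[u x] s IH] h /= [[ux _ _] _ cs].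
by rewrite inE => /predU1P[->//|]; exact: IH cs.
Qed.

(* If there were such a [K], it would contain a heaviest edge that is charged
   last, and the first boundary edge met on the rest of [K] would block it. *)
Lemma no_light_cycle delta h s T K (e : {set G}) : 0 < delta ->
  charged delta h s -> is_mst_favouring (charged_edges s) T ->
  K \subset T :|: charged_edges s -> bridgeless K -> e \in K ->
  (1 + delta) * weight e < edges_weight (K :\ e).
Proof.
move=> d0 cs favT KTB brK eK; rewrite ltNge; apply/negP => light.
have BE := charged_subset cs.
have KE : K \subset edges G.
  apply: fintype.subset_trans KTB _; rewrite finset.subUset BE andbT.
  by case: favT => -[[]].
have [f [fK fm]] : exists f, f \in K /\ forall g, g \in K -> weight g <= weight f.
  have [|f [fK fm]] := @finite_minimizer R _ (fun g => g \in K) (fun g => - weight g).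
    by exists e.
  by exists f; split=> // g /fm; rewrite lerN2.
have maxB g : g \in K -> weight g = weight f -> g \in charged_edges s.
  by move=> gK gf; apply: (heaviest_edge_favoured favT BE KTB brK gK); rewrite gf.
(* Passing from [e] to a heaviest edge [g] can only lighten the rest of [K] and raise the allowed
   length. *)
have lightg g : g \in K -> weight g = weight f ->
    edges_weight (K :\ g) <= (1 + delta) * weight g.
  move=> gK gf; have := edges_weightD1 gK; rewrite (edges_weightD1 eK).
  have := fm _ eK; rewrite gf => ef E.
  have : (1 + delta) * weight e <= (1 + delta) * weight f.
    by rewrite ler_wpM2l// addr_ge0// ltW.
  by lra.
pose P := [pred z | (pair_edge z \in K) && (weight (pair_edge z) == weight f)].
have has_heaviest : has P s.
  move: (maxB f fK erefl); rewrite inE => /mapP[z zs fE].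
  by apply/hasP; exists z => //=; rewrite -fE fK eqxx.
have [s1 [[u x] [s2 [sE /andP[/= gK /eqP gf] nP]]]] := split_last has_heaviest.
move: (cs); rewrite {1}sE => /charged_cat[cs1] /= [bux nb _].
set h' := h ++ _ in bux nb; have [_ uh xh] := bux.
set g := pair_edge (u, x) in gK gf.
have [p [up lp uup]] := connect_uniq_path (brK _ _ gK).
have [||p1 [d [p2 [pE uh1 dh]]]] := @first_exit _ (mem h') u p => //.
  by rewrite /= lp.
have KgE : K :\ g \subset edges G by apply: fintype.subset_trans (subD1set _ _) KE.
have : path (adj (K :\ g)) u (rcons p1 d).
  by move: up; rewrite pE -cat_rcons cat_path => /andP[].
move=> /[dup] up1; rewrite rcons_path => /andP[_].
rewrite /adj !inE => /andP[dNg dK].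
have uup1 : uniq (u :: rcons p1 d).
  by move: uup; rewrite pE -cat_rcons -cat_cons cat_uniq => /andP[].
have u1h : last u p1 \in h' by move/allP: uh1 => /(_ (last u p1)); apply; rewrite mem_last.
apply: nb; exists (last u p1), d; split=> //.
- by split=> //; exact: (fintype.subsetP KE).
(* Otherwise this edge is a heaviest one too, hence charged: if before [g], then [d] is already
   explored; it is not [g], which was deleted; if after [g], then [g] is not the last one. *)
- rewrite ltNge; apply/negP => ge.
  have ef : weight [set last u p1; d]%SET = weight f.
    by apply/eqP; rewrite eq_le fm//= -gf.
  move: (maxB _ dK ef); rewrite inE => /mapP[z zs zE].
  move: zs; rewrite sE mem_cat inE => /or3P[zs|/eqP zE'|zs].
  + by case/negP: dh; apply: charged_explored cs1 zs _; rewrite -zE set22.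
  + by case/negP: dNg; rewrite zE zE'.
  + by case/negP: nP; apply/hasP; exists z => //=; rewrite -zE dK ef eqxx.
(* The walk up to [d] uses distinct edges of [K] other than [g], so its length is at most their
   total weight. *)
- apply: le_trans (@dist_le R G _ _ _ _ (rcons p1 d) _) _.
    split=> //; last 1 first.
    + by rewrite belast_rcons /=; move: uh1 => /= /andP[].
    + by apply: sub_path up1 => a b; exact: (fintype.subsetP KgE).
    + by rewrite last_rcons.
  rewrite lee_fin; apply: le_trans (lightg _ gK gf).
  exact: walk_length_le_edges.
Qed.

Lemma no_light_path delta h s T a b p : 0 < delta ->
  charged delta h s -> is_mst_favouring (charged_edges s) T ->
  [set a; b]%SET \in T :|: charged_edges s ->
  is_path ((T :|: charged_edges s) :\ [set a; b]%SET) predT a b p ->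
  (1 + delta) * weight [set a; b]%SET < walk_length a p.
Proof.
set H := T :|: charged_edges s => d0 cs favT abH [ap lp up _].
have /allP pH : all (mem (H :\ [set a; b]%SET)) (walk_edges a p).
  by rewrite -path_walk_edges.
have abp : [set a; b]%SET \notin walk_edges a p.
  by apply/negP => /pH; rewrite /= !inE eqxx.
set K := [set e in [set a; b]%SET :: walk_edges a p]%SET.
have brK : bridgeless K by rewrite /K -lp; apply: cycle_bridgeless; rewrite ?lp.
have KH : K \subset H.
  apply/fintype.subsetP => e; rewrite inE in_cons => /predU1P[->//|/pH /=].
  by rewrite finset.in_setD1 => /andP[].
have HE : H \subset edges G.
  by rewrite finset.subUset (charged_subset cs) andbT; case: favT => -[[]].
apply: lt_le_trans (no_light_cycle d0 cs favT KH brK _) _; first by rewrite inE mem_head.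
apply: edges_weight_le_walk.
  apply: sub_path ap => x y; rewrite /adj finset.in_setD1 => /andP[_].
  exact: (fintype.subsetP HE).
move=> e; rewrite finset.in_setD1 inE in_cons => /andP[eab].
by rewrite (negPf eab).
Qed.

End Charged.

(** * The subgraph given by a connected edge set *)

Section SpanningSubgraph.
Variables (R : realType) (G : wgraph R) (F : {set {set G}}).
Hypotheses (FE : F \subset edges G) (cF : edge_connected F).

(** All vertices are kept, so that [delta] takes the same value as on [G]. *)
Definition spanning_subgraph : wgraph R :=
  @WGraph R G F (@weight R G)
    (fun e eF => edge_card (fintype.subsetP FE e eF))
    (fun e eF => weight_ge0 (fintype.subsetP FE e eF))
    (vert_gt0 G) cF.

Lemma spanning_subgraph_sub : subgraph spanning_subgraph G.
Proof.
exists (fun x : G => x); split=> // e eF; rewrite imset_id; split=> //.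
exact: (fintype.subsetP FE).
Qed.

End SpanningSubgraph.

(** * Lightness of the tree with the charged edges; trees and tours *)

Section Lightness.
Variables (R : realType) (G : wgraph R).
Implicit Types (T : {set {set G}}) (v : G) (p h : seq G) (s : seq (G * G)).
Implicit Type delta : R.

(** A spanner that omits an edge would contain a bypass of length at most [1 + delta] times its
    weight, which [no_light_path] excludes. So the whole edge set is the only spanner. *)
Lemma opt_span_charged_ge delta h s T
    (HE : T :|: charged_edges s \subset edges G)
    (cH : edge_connected (T :|: charged_edges s)) :
  0 < delta -> charged delta h s -> is_mst_favouring (charged_edges s) T ->
  ((edges_weight (T :|: charged_edges s) / edges_weight T)%:E <=
   opt_span (spanning_subgraph HE cH) delta)%E.
Proof.
set H := T :|: charged_edges s in HE cH *; move=> d0 cs favT.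
have [[sT mT] _] := favT; have [TE cT acT] := sT.
apply: le_ereal_inf_tmp => _ [F [T' [[FH sp] [[T'H cT' acT'] mT'] ->]]].
have -> : F = H.
  apply/eqP; rewrite finset.eqEsubset FH /=; apply/fintype.subsetP => e eH.
  have [a [b [ab eE]]] := edge_ends (fintype.subsetP HE _ eH); subst e.
  apply: contraT => eF.
  have : (dist (G := spanning_subgraph HE cH) F predT a b <=
          ((1 + delta) * weight [set a; b]%SET)%:E)%E.
    apply: le_trans (sp a b) _; rewrite EFinM lee_pmul2l//; last first.
      by rewrite lte_fin addr_gt0.
    apply: le_trans (@dist_le _ (spanning_subgraph HE cH) _ _ _ _ [:: b] _) _.
      by split=> //=; rewrite ?inE ?ab// andbT.
    by rewrite /= addr0.
  move=> /dist_attained[p [[ap lp up _] pl]].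
  suff : (1 + delta) * weight [set a; b]%SET < walk_length a p.
    by rewrite ltNge; move: pl => /= ->.
  apply: no_light_path d0 cs favT eH _; split=> //; last exact: all_predT.
  apply: sub_path ap => x y; rewrite /adj finset.in_setD1 => xyF.
  by rewrite (fintype.subsetP FH) // andbT; apply: contraNneq eF => <-.
suff -> : edges_weight T' = edges_weight T by [].
apply/eqP; rewrite eq_le (mT' T)/=; last by split=> //; exact: finset.subsetUl.
apply: mT; split=> //; exact: fintype.subset_trans T'H HE.
Qed.

(** Division by 0 yields 0, so for a tree of weight 0 the lightness carries no information and this
    case is separate. A charged edge outside [T] would be bypassed by a tree path of length 0, which
    is too short; hence all charged edges lie in [T]. *)
Lemma weight_charged_eq0 delta h s T :
  0 < delta -> charged delta h s -> is_mst_favouring (charged_edges s) T ->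
  edges_weight T = 0 -> edges_weight (charged_edges s) = 0.
Proof.
move=> d0 cs favT T0; have [[[TE cT _] _] _] := favT.
have BE := charged_subset cs.
suff BT : charged_edges s \subset T.
  by apply/eqP; rewrite eq_le edges_weight_ge0// -T0 edges_weightS.
apply/fintype.subsetP => e eB; apply: contraT => eT.
have [a [b [ab eE]]] := edge_ends (fintype.subsetP BE _ eB); subst e.
have [p [ap lp up]] := connect_uniq_path (cT a b).
have : (1 + delta) * weight [set a; b]%SET < walk_length a p.
  apply: no_light_path d0 cs favT _ _; first by rewrite finset.in_setU eB orbT.
  split=> //; last exact: all_predT.
  apply: sub_path ap => x y; rewrite /adj finset.in_setD1 finset.in_setU => xyT.
  by rewrite [_ \in T]xyT andbT; apply: contraNneq eT => <-.
have := walk_length_le_edges TE up ap; rewrite T0 => wp.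
rewrite ltNge (le_trans wp)// mulr_ge0//; first by rewrite addr_ge0// ltW.
by apply: weight_ge0; exact: (fintype.subsetP BE).
Qed.

(** The edges of a tour connect all vertices and hence contain a spanning tree. *)
Lemma mst_le_opt T : is_mst T -> ((edges_weight T)%:E <= opt G)%E.
Proof.
move=> [_ mT]; apply: le_ereal_inf_tmp => _ [v [p [[vp _ vis] ->]]].
set K := [set e in walk_edges v p]%SET.
have KE : K \subset edges G.
  move: (vp); rewrite path_walk_edges => /allP vpE.
  by apply/fintype.subsetP => e; rewrite inE => /vpE.
have cv z : connect (adj K) v z by exact: walk_connect_mem.
have [|T0 T0K sT0] := spanning_tree_exists KE.
  by move=> x y; apply: connect_trans (cv y); rewrite connect_adjC.
rewrite lee_fin; apply: le_trans (mT _ sT0) _.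
apply: edges_weight_le_walk vp _ => e /(fintype.subsetP T0K).
by rewrite inE.
Qed.

End Lightness.

(** * Cost of the walk *)

Section Exploration.
Variables (R : realType) (G : wgraph R) (delta : R).
Hypothesis delta_gt0 : 0 < delta.
Implicit Types (F : {set {set G}}) (S : pred G) (u v x y : G) (p q h t : seq G).
Implicit Types (s : seq (G * G)).

Lemma is_path_all F S x y p : is_path F S x y p -> S x -> S y -> all S (x :: p).
Proof.
move=> [_ lp _ aS] Sx Sy; rewrite lastI all_rcons lp Sy /=.
by case: p lp aS => //= z p _ ->; rewrite Sx.
Qed.

Lemma walk_length_rev x p :
  walk_length (last x p) (rev (belast x p)) = walk_length x p.
Proof.
elim: p x => //= y p IH x.
rewrite rev_cons -cats1 walk_length_cat IH last_rev_belast /= addr0 addrC.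
by rewrite finset.setUC.
Qed.

Lemma is_path_rev F S x y p : is_path F S x y p ->
  is_path F S y x (rev (belast x p)).
Proof.
move=> [xp <- up aS]; split.
- rewrite rev_path (eq_path (e' := adj F))//.
  by move=> a b; rewrite /= adj_sym.
- exact: last_rev_belast.
- by rewrite -rev_rcons -lastI rev_uniq.
- case/lastP: p aS {xp up} => // p z.
  by rewrite !belast_rcons last_rcons /= rev_cons belast_rcons /= all_rev.
Qed.

(** Either [y] is [v], or [y] was this close to [v] when the edge was blocked, and a path explored
    then remains explored. *)
Lemma eligible_path h v y x : eligible delta h v y x -> v \in h ->
  exists r, [/\ is_path (edges G) (mem h) y v r, {subset y :: r <= h}
    & walk_length y r <= (1 + delta) * weight [set y; x]%SET].
Proof.
move=> [[yx yh xh] _ elig] vh.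
suff [r [rP rl]] : exists r, is_path (edges G) (mem h) y v r /\
    walk_length y r <= (1 + delta) * weight [set y; x]%SET.
  by exists r; split=> //; apply/allP; exact: is_path_all rP yh vh.
have w0 : 0 <= weight [set y; x]%SET by exact: weight_ge0.
case: elig => [<-|[k [u' [kh [_ _ _]]]]].
  exists [::]; split; first by split.
  by rewrite /= mulr_ge0// addr_ge0// ltW.
move=> /dist_attained[r [rP rl]]; exists r; split=> //.
by apply: sub_is_path rP => z; exact: mem_take.
Qed.

(** Each charged edge of weight [w] costs at most [(1 + delta) w] for the way out, [w] for its
    traversal and [(2 + delta) w] for the way back, altogether [2 (delta + 2) w]. *)
Lemma blocking_charged v h h' t : blocking delta v h h' t -> v \in h ->
  exists s, [/\ charged delta h s, h' = h ++ map snd s,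
    path (adj (edges G)) v t /\ last v t = v,
    {subset map snd s <= t}
  & walk_length v t <= 2 * (delta + 2) * \sum_(z <- s) weight (pair_edge z)].
Proof.
elim=> {v h h' t} [v h _ _|v h h1 h2 y x p q t1 t2 el [pP pm] _ IH1 [qP qm] _ IH2 vh].
  by exists [::]; rewrite cats0 big_nil mulr0.
have [r [rP rh rl]] := eligible_path el vh.
have [[yx yh xh] nbl _] := el.
have [|s1 [cs1 h1E [xt1 lt1] st1 wt1]] := IH1; first by rewrite mem_rcons mem_head.
have hh1 : {subset h <= h1} by move=> z zh; rewrite h1E mem_cat mem_rcons inE zh orbT.
have [|s2 [cs2 h2E [vt2 lt2] st2 wt2]] := IH2; first exact: hh1.
exists ((y, x) :: s1 ++ s2); split.
- by split=> //; apply/charged_cat; rewrite -h1E.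
- by rewrite h2E h1E /= map_cat -catA cat_rcons.
- have [vp lp _ _] := pP; have [xq lq _ _] := qP.
  rewrite cat_path vp lp /= [adj _ _ _]yx cat_path xt1 lt1 cat_path xq lq vt2.
  by rewrite last_cat /= !last_cat lt1 lq lt2.
- move=> z; rewrite /= map_cat inE mem_cat => /or3P[/eqP->|/st1 zt|/st2 zt].
  + by rewrite mem_cat mem_head orbT.
  + by rewrite mem_cat inE mem_cat zt !orbT.
  + by rewrite mem_cat inE !mem_cat zt !orbT.
have wp : walk_length v p <= (1 + delta) * weight [set y; x]%SET.
  have [_ ly _ _] := rP.
  apply: le_trans (pm _ (is_path_rev rP)) _.
  by rewrite -[X in walk_length X]ly walk_length_rev.
(* One way back is across the edge and then along [r]; it is still explored in [h1]. *)
have wq : walk_length x q <= (2 + delta) * weight [set y; x]%SET.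
  apply: le_trans (qm (y :: r) _) _.
    have [yr ly ur _] := rP; split=> //=.
    + by rewrite adj_sym [adj _ _ _]yx.
    + by move: ur => /= ->; rewrite andbT; apply: contra xh => /rh.
    + by apply/allP => z /mem_belast /rh /hh1.
  by rewrite /= finset.setUC; lra.
have [_ lp _ _] := pP; have [_ lq _ _] := qP.
rewrite walk_length_cat lp /= !walk_length_cat lt1 lq big_cons big_cat /=.
rewrite {1}/pair_edge /=.
rewrite !mulrDr.
lra.
Qed.

(** * Every vertex gets explored *)

Lemma charged_uniq_explored h s : charged delta h s -> uniq h -> uniq (h ++ map snd s).
Proof.
elim: s h => [|[u x] s IH] h /=; first by rewrite cats0.
move=> [[_ _ xh] _ cs] uh; rewrite -cat_rcons; apply: IH => //.
by rewrite rcons_uniq xh.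
Qed.

(** Every newly explored vertex gets its own call, and later states only extend the one in which
    that call ended. This recovers, for each [z], a state without eligible edges for [z]. *)
Lemma blocking_finished v h h' t : blocking delta v h h' t -> v \in h ->
  prefix h h' /\ forall z, z = v \/ (z \in h' /\ z \notin h) ->
    exists h'', [/\ prefix h'' h', z \in h''
      & forall y x, ~ eligible delta h'' z y x].
Proof.
elim=> {v h h' t} [v h nel vh|v h h1 h2 y x p q t1 t2 _ _ _ IH1 _ _ IH2 vh].
  split; first exact: prefix_refl.
  move=> z [->|[zh /negP[]//]]; exists h; split=> //; exact: prefix_refl.
have [|pre1 fin1] := IH1; first by rewrite mem_rcons mem_head.
have pre : prefix h h1 by apply: prefix_trans pre1; exact: prefix_rcons.
have [|pre2 fin2] := IH2.
  by move/prefixP: pre => [g ->]; rewrite mem_cat vh.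
split; first exact: prefix_trans pre2.
move=> z [->|[zh2 zh]]; first by apply: fin2; left.
have [zh1|zh1] := boolP (z \in h1); last by apply: fin2; right.
have [|h'' [pre'' zh'' nel]] := fin1 z.
  have [->|zx] := eqVneq z x; [by left|right; split=> //].
  by rewrite mem_rcons inE negb_or zx.
exists h''; split=> //; exact: prefix_trans pre2.
Qed.

(** More explored vertices only shorten distances, so a block persists while [x] and [x'] stay
    unexplored. *)
Lemma blocked_by_later h h' u x u' x' : blocked_by delta h u x u' x' ->
  {subset h <= h'} -> x \notin h' -> x' \notin h' ->
  blocked_by delta h' u x u' x'.
Proof.
move=> [[ux uh _] [ux' uh' _] wlt dle] hh' xh' xh''.
split=> //; [by split=> //; exact: hh'|by split=> //; exact: hh'|].
apply: le_trans dle; apply: ereal_inf_le_tmp => _ [p pP <-]; exists p => //.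
by apply: sub_is_path pP => z; exact: hh'.
Qed.

(* Consider the last time at which a lightest remaining boundary edge was blocked.
   The blocking edge stops blocking because its endpoint gets explored, so the call
   at that endpoint could not end without traversing the boundary edge. *)
Lemma blocking_explores v h t : blocking delta v [:: v] h t -> forall x, x \in h.
Proof.
move=> bl; have vv : v \in [:: v] by rewrite mem_head.
have [s [cs hE _ _ _]] := blocking_charged bl vv.
have uh : uniq h by rewrite hE; exact: charged_uniq_explored cs _.
have [_ fin] := blocking_finished bl vv.
have {}fin z : z \in h -> exists m, [/\ (m <= size h)%N, z \in take m h
    & forall y x, ~ eligible delta (take m h) z y x].
  move=> zh; have [|h'' [pre zh'' nel]] := fin z.
    by rewrite inE; case: eqVneq; [left|right].
  exists (size h''); rewrite prefixE in pre.
  by rewrite (eqP pre); split=> //; rewrite -[in leqLHS](eqP pre) size_take_min geq_minr.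
suff nob : forall y x, ~ boundary h y x.
  move=> x; apply: contraT => xh.
  have vh : v \in h by rewrite hE mem_cat vv.
  have [c [d [cd ch dh]]] := connect_exit (graph_connected v x) (vh : mem h v) xh.
  by case: (nob c d).
move=> y0 x0 b0.
have [|[y x] [/= byx minyx]] := @finite_minimizer R _
    (fun z : G * G => boundary h z.1 z.2) (fun z => weight (pair_edge z)).
  by exists (y0, x0).
have [yx yh xh] := byx.
have xtk k : x \notin take k h by apply: contra xh; exact: mem_take.
pose P k := `[< blocked delta (take k h) y x >] && (k <= size h)%N.
(* The call at [y] ended with its own edge [yx] on the boundary, so only a block can have prevented
   the traversal. *)
have exP : exists k, P k.
  have [m [mh ym nel]] := fin y yh; exists m; rewrite /P mh andbT.
  apply/asboolP; apply: contrapT => nb; apply: (nel y x).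
  by split=> //; left.
have bdP k : P k -> (k <= size h)%N by case/andP.
case: (ex_maxnP exP bdP) => K /andP[/asboolP[u' [x' bK]] Kh] maxK.
have Klt : (K < size h)%N.
  rewrite ltn_neqAle Kh andbT; apply/eqP => KE.
  move: bK; rewrite KE take_size => -[_ bd' wlt _].
  by have := minyx (u', x') bd'; rewrite leNgt wlt.
(* Were [x'] unexplored in the next state, the block would persist, against the choice of [K]. *)
have x'K : x' \in take K.+1 h.
  apply: contraT => x'h.
  suff /maxK : P K.+1 by rewrite ltnn.
  rewrite /P Klt andbT; apply/asboolP; exists u', x'.
  apply: blocked_by_later bK _ (xtk _) x'h => z zK.
  by rewrite (take_nth x Klt) mem_rcons inE zK orbT.
have [m [mh x'm nel]] := fin x' (mem_take x'K).
have Km : (K < m)%N.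
  rewrite ltnNge; apply/negP => mK; have [_ [_ _ /negP x'h] _ _] := bK; apply: x'h.
  by move: x'm; rewrite -[in take m h](minn_idPl mK) take_min => /mem_take.
(* When the call at [x'] ends, after state [K], the edge [yx] is no longer blocked by maximality of
   [K], but it was blocked in state [K] by an edge ending in [x']. *)
apply: (nel y x); split.
- split=> //; have [[_ yK _] _ _ _] := bK.
  by move: yK; rewrite -[in take K h](minn_idPl (ltnW Km)) take_min => /mem_take.
- move=> nb; have /maxK : P m by rewrite /P mh andbT; apply/asboolP.
  by rewrite leqNgt Km.
- right; exists K, u'; rewrite size_take_min leq_min Km Klt; split=> //.
  by rewrite -take_min (minn_idPl (ltnW Km)).
Qed.

(** * Existence of a run *)

Definition explored_connected h : Prop :=
  {in h &, forall a b, exists p, is_path (edges G) (mem h) a b p}.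

Lemma explored_connected_rcons h u x : explored_connected h ->
  boundary h u x -> explored_connected (rcons h x).
Proof.
move=> ch [ux uh xh].
have sub : {subset mem h <= mem (rcons h x)}.
  by move=> z zh; rewrite [_ \in _]mem_rcons inE zh orbT.
have tox a : a \in h -> exists p, is_path (edges G) (mem (rcons h x)) a x p.
  move=> ah; have [p pP] := ch a u ah uh.
  have /allP ap := is_path_all pP ah uh; have [pa lp up _] := pP.
  exists (rcons p x); split.
  - by rewrite rcons_path pa lp.
  - by rewrite last_rcons.
  - by rewrite -rcons_cons rcons_uniq up andbT; apply: contra xh => /ap.
  - by rewrite belast_rcons /=; apply/allP => z zp; apply: sub; apply: ap; rewrite inE zp orbT.
move=> a b; rewrite !mem_rcons !inE => /predU1P[->|ah] /predU1P[->|bh].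
- by exists [::].
- by have [p /is_path_rev] := tox b bh; eexists; eassumption.
- exact: tox.
- by have [p pP] := ch a b ah bh; exists p; apply: sub_is_path pP.
Qed.

Lemma explored_connected_charged h s : explored_connected h ->
  charged delta h s -> explored_connected (h ++ map snd s).
Proof.
elim: s h => [|[u x] s IH] h ch /=; first by rewrite cats0.
move=> [bx _ cs]; rewrite -cat_rcons; apply: IH => //.
exact: explored_connected_rcons bx.
Qed.

(** Induction on the number of unexplored vertices, which exploring [x] lowers for both subsequent
    calls. The explored part stays connected, which provides the walks to [y] and back to [v]. *)
Lemma blocking_exists v h : v \in h -> explored_connected h ->
  exists h' t, blocking delta v h h' t.
Proof.
have [n] := ubnP #|[predC h]|; elim: n v h => // n IH v h hn vh ch.
have [[y [x el]]|nel] := pselect (exists y x, eligible delta h v y x); last first.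
  by exists h, [::]; apply: BlockingDone => y x el; apply: nel; exists y, x.
have [bx _ _] := el; have [_ yh xh] := bx.
have lt (g : seq G) : x \in g -> {subset h <= g} -> (#|[predC g]| < n)%N.
  move=> xg hg; apply: leq_trans (hn : _ <= n)%N; apply: proper_card; apply/properP; split.
    by apply/fintype.subsetP => z; rewrite !inE; apply: contra; exact: hg.
  by exists x; rewrite !inE ?xg.
have xr : x \in rcons h x by rewrite mem_rcons mem_head.
have hr : {subset h <= rcons h x} by move=> z zh; rewrite mem_rcons inE zh orbT.
have [p pP] := shortest_path_exists (ch v y vh yh).
have cr := explored_connected_rcons ch bx.
have [h1 [t1 bl1]] := IH x _ (lt _ xr hr) xr cr.
have [s1 [cs1 h1E _ _ _]] := blocking_charged bl1 xr.
have c1 : explored_connected h1 by rewrite h1E; exact: explored_connected_charged.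
have rh1 : {subset rcons h x <= h1} by move=> z zr; rewrite h1E mem_cat zr.
have vh1 : v \in h1 by apply/rh1/hr.
have [q qP] := shortest_path_exists (c1 x v (rh1 _ xr) vh1).
have [|h2 [t2 bl2]] := IH v _ (lt _ (rh1 _ xr) _) vh1 c1.
  by move=> z /hr/rh1.
by exists h2, (p ++ x :: t1 ++ q ++ t2); exact: BlockingStep el pP bl1 qP bl2.
Qed.

End Exploration.

(** * The competitive ratio *)

Theorem theorem9 (R : realType) (C : wgraph R -> Prop) (delta : nat -> R)
    (C_monotone : monotone_gclass C) (delta_gt0 : forall n, 0 < delta n) :
  competitive
    (fun n => ((2 * (delta n + 2))%:E * opt_span_class delta C)%E)
    C (blocking_alg delta).
Proof.
move=> G CG v; have vv : v \in [:: v] by rewrite mem_head.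
set d := delta #|G|; have d0 : 0 < d by exact: delta_gt0.
split.
  have [|h [t bl]] := @blocking_exists R G d d0 v [:: v] vv; last by exists t, h.
  by move=> a b; rewrite !inE => /eqP-> /eqP->; exists [::].
move=> t [h bl]; have [s [cs hE [vt lt] st wt]] := blocking_charged d0 bl vv.
have all_h := blocking_explores d0 bl.
split.
  split=> // x; have := all_h x; rewrite hE mem_cat !inE => /orP[->//|/st ->].
  by rewrite orbT.
have [T favT] := mst_favouring_exists (charged_edges s).
have [mT _] := favT; have [[TE cT _] _] := mT.
have BE := charged_subset cs.
have HE : T :|: charged_edges s \subset edges G by rewrite finset.subUset TE.
have cH : edge_connected (T :|: charged_edges s).
  by move=> x y; apply: connect_sub_adj (cT x y); exact: finset.subsetUl.
set H := T :|: charged_edges s in HE cH.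
set r := edges_weight H / edges_weight T.
have T0 := edges_weight_ge0 TE; have H0 := edges_weight_ge0 HE.
have r0 : 0 <= r by rewrite divr_ge0.
have rO : (r%:E <= opt_span_class delta C)%E.
  apply: le_trans (opt_span_charged_ge HE cH d0 cs favT) _.
  apply: ereal_sup_ubound; exists (spanning_subgraph HE cH); split=> //.
  exact: C_monotone CG (spanning_subgraph_sub HE cH).
(* If [T] has weight 0, the quotient [r] cannot be cleared, but then both sides are 0. *)
have BrT : edges_weight (charged_edges s) <= r * edges_weight T.
  have [E|N] := eqVneq (edges_weight T) 0.
    by rewrite E mulr0 (weight_charged_eq0 d0 cs favT E).
  by rewrite divfK//; apply: edges_weightS HE; exact: finset.subsetUr.
have sB : \sum_(z <- s) weight (pair_edge z) = edges_weight (charged_edges s).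
  rewrite -(big_map (@pair_edge R G) predT (@weight R G)).
  rewrite big_uniq ?(charged_uniq cs)//=.
  by apply: eq_bigl => e; rewrite inE.
have c0 : 0 <= 2 * (d + 2) by rewrite mulr_ge0// addr_ge0// ltW.
apply: (@le_trans _ _ ((2 * (d + 2) * r)%:E * (edges_weight T)%:E)%E).
  rewrite -EFinM lee_fin -(mulrA _ r); apply: le_trans wt _.
  by rewrite sB ler_wpM2l.
apply: lee_pmul; rewrite ?lee_fin//; first by rewrite mulr_ge0.
  by rewrite EFinM lee_pmul// lee_fin.
exact: mst_le_opt.
Qed.
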